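(* Every two-sided skew brace is the extension of a weakly trivial skew brace by a two-sided brace; that is, every two-sided skew brace $A$ has an ideal $I$ such that $I$ (with the restricted operations) is a two-sided brace and the quotient skew brace $A/I$ is weakly trivial.
   Context: A skew (left) brace is a triple $(A,+,\circ)$ such that $(A,+)$ and $(A,\circ)$ are (not necessarily abelian) groups and $a\circ(b+c)=a\circ b-a+a\circ c$ for all $a,b,c\in A$. The two groups share the same identity element, denoted $0$. It is two-sided if moreover $(a+b)\circ c=a\circ c-c+b\circ c$ for all $a,b,c\in A$. A (left) brace is a skew brace whose additive group is abelian; a two-sided brace is a brace that is two-sided. An ideal of $A$ is a subset $I$ that is a normal subgroup of both $(A,+)$ and $(A,\circ)$ and satisfies $-a+a\circ x\in I$ for all $a\in A$, $x\in I$; the quotient $A/I$ is then naturally a skew brace. For $a,b\in A$ put $a*b=-a+a\circ b-b$ and $a*_{\mathrm{op}}b=-b+a\circ b-a$. Let $A^2$ be the subgroup of $(A,+)$ generated by all $a*b$, and $A^2_{\mathrm{op}}$ the subgroup of $(A,+)$ generated by all $a*_{\mathrm{op}}b$. A skew brace $A$ is weakly trivial if $A^2\cap A^2_{\mathrm{op}}=\{0\}$. *)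

(* Defs.v *)
From HB Require Import structures.
From mathcomp Require Import all_boot.
From mathcomp Require Import boolp classical_sets.

Set Implicit Arguments.
Unset Strict Implicit.
Unset Printing Implicit Defensive.

Declare Scope skew_brace_scope.
Delimit Scope skew_brace_scope with SB.

Local Open Scope classical_set_scope.
Local Open Scope quotient_scope.
Local Open Scope skew_brace_scope.

(* The [groupType] structure of [A] is (A, ∘), and the mixin adds the group
   (A, +), with its own operations since MathComp's additive structures are
   commutative.  The common identity is not an axiom, see [sb_one]. *)
HB.mixin Record isSkewBrace A of Group A := {
  sbadd : A -> A -> A;
  sbzero : A;
  sbopp : A -> A;
  sbaddA : associative sbadd;
  sbadd0 : left_id sbzero sbadd;
  sbaddN : left_inverse sbzero sbopp sbadd;
  circDr : forall a b c : A,
    (a * sbadd b c)%g = sbadd (sbadd (a * b)%g (sbopp a)) (a * c)%g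
}.

#[short(type="skewBraceType")]
HB.structure Definition SkewBrace := {A of isSkewBrace A & Group A}.

Bind Scope skew_brace_scope with SkewBrace.sort.

Notation "a ∘ b" := (a * b)%g (at level 40, left associativity)
  : skew_brace_scope.
Notation "a + b" := (sbadd a b) : skew_brace_scope.
Notation "- a" := (sbopp a) : skew_brace_scope.
Notation "a - b" := (sbadd a (sbopp b)) : skew_brace_scope.
Notation "0" := (@sbzero _) : skew_brace_scope.

Section AddGroupTheory.
Variable A : skewBraceType.
Implicit Types x y z : A.

Lemma sbaddK x y : - x + (x + y) = y.
Proof. by rewrite sbaddA sbaddN sbadd0. Qed.

Lemma sbaddI x y z : x + y = x + z -> y = z.
Proof. by move=> e; rewrite -(sbaddK x y) e sbaddK. Qed.

Lemma sbaddr0 x : x + 0 = x.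
Proof. by apply: (@sbaddI (- x)); rewrite sbaddA sbaddN sbadd0. Qed.

Lemma sbsubrr x : x - x = 0.
Proof. by apply: (@sbaddI (- x)); rewrite sbaddK sbaddr0. Qed.

Lemma sboppK x : - - x = x.
Proof. by apply: (@sbaddI (- x)); rewrite sbsubrr sbaddN. Qed.

Lemma sbopp0 : - 0 = 0 :> A.
Proof. by rewrite -[LHS]sbadd0 sbsubrr. Qed.

Lemma sboppD x y : - (x + y) = - y - x.
Proof.
apply: (@sbaddI (x + y)).
by rewrite sbsubrr -sbaddA (sbaddA y) sbsubrr sbadd0 sbsubrr.
Qed.
End AddGroupTheory.

Section SkewBraceTheory.
Variable A : skewBraceType.
Implicit Types (a b c x : A) (H : set A).

Lemma circ0 a : a ∘ 0 = a.
Proof.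
have := circDr a 0 0; rewrite sbadd0 -[LHS]sbaddr0 -sbaddA => /sbaddI e.
by rewrite -[LHS](sbaddK (- a)) sboppK -e sbaddr0.
Qed.

Lemma sb_one : 1%g = 0 :> A.
Proof. by rewrite -(circ0 1%g) mul1g. Qed.

Lemma circN a b : a ∘ (- b) = a - a ∘ b + a.
Proof.
apply: (@sbaddI A (a ∘ b - a)).
by rewrite -circDr sbsubrr circ0 -!sbaddA sbaddK (sbaddA (a ∘ b)) sbsubrr sbadd0.
Qed.

Definition two_sided :=
  forall a b c : A, (a + b) ∘ c = a ∘ c - c + b ∘ c.

Definition brace := commutative (@sbadd A).

Definition two_sided_brace := brace /\ two_sided.

Record add_subgroup H : Prop := AddSubgroup {
  add_subgroup0 : H 0;
  add_subgroupD : forall x y, H x -> H y -> H (x + y);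
  add_subgroupN : forall x, H x -> H (- x)
}.

Record circ_subgroup H : Prop := CircSubgroup {
  circ_subgroup1 : H 1%g;
  circ_subgroupM : forall x y, H x -> H y -> H (x ∘ y);
  circ_subgroupV : forall x, H x -> H x^-1%g
}.

Record is_ideal H : Prop := IsIdeal {
  ideal_add : add_subgroup H;
  ideal_add_normal : forall a x, H x -> H (a + x - a);
  ideal_circ : circ_subgroup H;
  ideal_circ_normal : forall a x, H x -> H (a ∘ x ∘ a^-1)%g;
  ideal_lambda : forall a x, H x -> H (- a + a ∘ x)
}.

Definition star a b := - a + a ∘ b - b.
Definition starop a b := - b + a ∘ b - a.

Definition add_gen (X : set A) : set A := smallest add_subgroup X.

Definition A2 : set A := add_gen [set star a b | a in setT & b in setT].
Definition A2op : set A := add_gen [set starop a b | a in setT & b in setT].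

Definition weakly_trivial := A2 `&` A2op = [set 0].

End SkewBraceTheory.

Arguments two_sided A : clear implicits.
Arguments brace A : clear implicits.
Arguments two_sided_brace A : clear implicits.
Arguments A2 A : clear implicits.
Arguments A2op A : clear implicits.
Arguments weakly_trivial A : clear implicits.

Record ideal (A : skewBraceType) := Ideal {
  ideal_set :> A -> Prop;
  idealP : is_ideal ideal_set
}.

Section IdealTheory.
Variables (A : skewBraceType) (I : ideal A).
Implicit Types a b x y : A.

Lemma ideal0 : I 0. Proof. exact: add_subgroup0 (ideal_add (idealP I)). Qed.
Lemma idealD x y : I x -> I y -> I (x + y).
Proof. exact: add_subgroupD (ideal_add (idealP I)) _ _. Qed.
Lemma idealN x : I x -> I (- x).
Proof. exact: add_subgroupN (ideal_add (idealP I)) _. Qed.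
Lemma ideal1 : I 1%g. Proof. exact: circ_subgroup1 (ideal_circ (idealP I)). Qed.
Lemma idealM x y : I x -> I y -> I (x ∘ y).
Proof. exact: circ_subgroupM (ideal_circ (idealP I)) _ _. Qed.
Lemma idealV x : I x -> I x^-1%g.
Proof. exact: circ_subgroupV (ideal_circ (idealP I)) _. Qed.
Lemma idealJ a x : I x -> I (a + x - a).
Proof. exact: ideal_add_normal (idealP I) _ _. Qed.
Lemma idealJV a x : I x -> I (- a + x + a).
Proof. by move/(idealJ (- a)); rewrite sboppK. Qed.
Lemma idealJg a x : I x -> I (a ∘ x ∘ a^-1)%g.
Proof. exact: ideal_circ_normal (idealP I) _ _. Qed.
Lemma idealL a x : I x -> I (- a + a ∘ x).
Proof. exact: ideal_lambda (idealP I) _ _. Qed.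

Definition ideal_sub := {x : A | x \in (ideal_set I : set A)}.
HB.instance Definition _ := [isSub of ideal_sub for sval].
HB.instance Definition _ := [Choice of ideal_sub by <:].
Implicit Types u v w : ideal_sub.

Lemma ideal_subP u : I (val u). Proof. exact: set_mem (valP u). Qed.

Definition mk_sub x (Ix : I x) : ideal_sub := exist _ x (mem_set Ix).

Definition sub_zero := mk_sub ideal0.
Definition sub_opp u := mk_sub (idealN (ideal_subP u)).
Definition sub_add u v := mk_sub (idealD (ideal_subP u) (ideal_subP v)).
Definition sub_one := mk_sub ideal1.
Definition sub_inv u := mk_sub (idealV (ideal_subP u)).
Definition sub_circ u v := mk_sub (idealM (ideal_subP u) (ideal_subP v)).


Fact sub_addA : associative sub_add.
Proof. by move=> u v w; apply: val_inj; apply: sbaddA. Qed.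
Fact sub_add0 : left_id sub_zero sub_add.
Proof. by move=> u; apply: val_inj; apply: sbadd0. Qed.
Fact sub_addN : left_inverse sub_zero sub_opp sub_add.
Proof. by move=> u; apply: val_inj; apply: sbaddN. Qed.

Fact sub_circA : associative sub_circ.
Proof. by move=> u v w; apply: val_inj; apply: mulgA. Qed.
Fact sub_mul1 : left_id sub_one sub_circ.
Proof. by move=> u; apply: val_inj; apply: mul1g. Qed.
Fact sub_mulr1 : right_id sub_one sub_circ.
Proof. by move=> u; apply: val_inj; apply: mulg1. Qed.
Fact sub_mulV : left_inverse sub_one sub_inv sub_circ.
Proof. by move=> u; apply: val_inj; apply: mulVg. Qed.
Fact sub_mulrV : right_inverse sub_one sub_inv sub_circ.
Proof. by move=> u; apply: val_inj; apply: mulgV. Qed.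
HB.instance Definition _ := isGroup.Build ideal_sub
  sub_circA sub_mul1 sub_mulr1 sub_mulV sub_mulrV.

Fact sub_circDr u v w : sub_circ u (sub_add v w) =
  sub_add (sub_add (sub_circ u v) (sub_opp u)) (sub_circ u w).
Proof. by apply: val_inj; apply: circDr. Qed.
HB.instance Definition _ := isSkewBrace.Build ideal_sub
  sub_addA sub_add0 sub_addN sub_circDr.

(* The classes are the cosets [x + I], equal to [x ∘ I] by [ideal_equivM]. *)
Definition ideal_equiv x y : bool := `[< I (- x + y) >].

Fact ideal_equiv_class : equiv_class_of ideal_equiv.
Proof.
have symE x y : ideal_equiv x y -> ideal_equiv y x.
  by move/asboolP/idealN => h; apply/asboolP; rewrite sboppD sboppK in h.
split=> [x|x y|y x z].
- by apply/asboolP; rewrite sbaddN; exact: ideal0.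
- by apply/idP/idP; apply: symE.
- move=> /asboolP h1 /asboolP h2; apply/asboolP.
  by have := idealD h1 h2; rewrite -sbaddA (sbaddA y) sbsubrr sbadd0.
Qed.

Canonical ideal_equiv_equiv := EquivRelPack ideal_equiv_class.
Canonical ideal_equiv_encModRel := defaultEncModRel ideal_equiv.

Definition ideal_quot := {eq_quot ideal_equiv}.
HB.instance Definition _ : EqQuotient A ideal_equiv ideal_quot :=
  EqQuotient.on ideal_quot.
HB.instance Definition _ := Choice.on ideal_quot.

Lemma ideal_quotP x y :
  I (- x + y) <-> \pi_ideal_quot x = \pi_ideal_quot y.
Proof.
by split=> [h|/eqmodP/asboolP //]; apply/eqmodP/asboolP.
Qed.

Definition quot_zero : ideal_quot := lift_cst ideal_quot (@sbzero A).
Definition quot_opp := lift_op1 ideal_quot (@sbopp A).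
Definition quot_add := lift_op2 ideal_quot (@sbadd A).
Definition quot_one : ideal_quot := lift_cst ideal_quot 1%g.
Definition quot_inv := lift_op1 ideal_quot (@inv A).
Definition quot_circ := lift_op2 ideal_quot (@mul A).

Lemma quot_reprP x : I (- x + repr (\pi_ideal_quot x)).
Proof. by apply/ideal_quotP; rewrite reprK. Qed.

Lemma ideal_equivM x y : I (- x + y) <-> I (x^-1 * y)%g.
Proof.
split=> h.
  have := idealL x^-1%g h.
  rewrite circDr circN mulVg sb_one sbopp0 sbaddr0 -!sbaddA sbaddK.
  by rewrite sbaddA sbsubrr sbadd0.
by have := idealL x h; rewrite mulVKg.
Qed.

Lemma pi_quot_add : {morph \pi_ideal_quot : x y / x + y >-> quot_add x y}.
Proof.
move=> x y; unlock quot_add; apply/ideal_quotP; rewrite sboppD.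
set x' := repr _; set y' := repr _.
have -> : - y - x + (x' + y') = (- y + (- x + x') + y) + (- y + y').
  by rewrite -!sbaddA (sbaddA y) sbsubrr sbadd0.
by apply: idealD; [apply: idealJV|]; apply: quot_reprP.
Qed.

Lemma pi_quot_opp : {morph \pi_ideal_quot : x / - x >-> quot_opp x}.
Proof.
move=> x; unlock quot_opp; apply/ideal_quotP; rewrite sboppK.
have := idealJ x (idealN (quot_reprP x)).
by rewrite sboppD sboppK -!sbaddA sbsubrr sbaddr0.
Qed.

Lemma pi_quot_circ : {morph \pi_ideal_quot : x y / x ∘ y >-> quot_circ x y}.
Proof.
move=> x y; unlock quot_circ; apply/ideal_quotP/ideal_equivM.
set x' := repr _; set y' := repr _.
have -> : ((x * y)^-1 * (x' * y'))%g =
    (y^-1 * (x^-1 * x') * y^-1^-1 * (y^-1 * y'))%g.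
  by rewrite invgK invgM !mulgA mulgK.
by apply: idealM; [apply: idealJg|]; apply/ideal_equivM/quot_reprP.
Qed.

Lemma pi_quot_inv : {morph \pi_ideal_quot : x / x^-1%g >-> quot_inv x}.
Proof.
move=> x; unlock quot_inv; apply/ideal_quotP/ideal_equivM.
have /ideal_equivM/idealV/(idealJg x) := quot_reprP x.
by rewrite invgK invgM invgK mulgA mulgK.
Qed.

Lemma pi_quot_zero : \pi_ideal_quot 0 = quot_zero.
Proof. by rewrite /quot_zero; unlock. Qed.
Lemma pi_quot_one : \pi_ideal_quot 1%g = quot_one.
Proof. by rewrite /quot_one; unlock. Qed.

Fact quot_addA : associative quot_add.
Proof. by do 3!elim/quotW=> ?; rewrite -!pi_quot_add sbaddA. Qed.
Fact quot_add0 : left_id quot_zero quot_add.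
Proof. by elim/quotW=> ?; rewrite -pi_quot_zero -pi_quot_add sbadd0. Qed.
Fact quot_addN : left_inverse quot_zero quot_opp quot_add.
Proof.
by elim/quotW=> ?; rewrite -pi_quot_opp -pi_quot_add sbaddN pi_quot_zero.
Qed.
Fact quot_circA : associative quot_circ.
Proof. by do 3!elim/quotW=> ?; rewrite -!pi_quot_circ mulgA. Qed.
Fact quot_mul1 : left_id quot_one quot_circ.
Proof. by elim/quotW=> ?; rewrite -pi_quot_one -pi_quot_circ mul1g. Qed.
Fact quot_mulr1 : right_id quot_one quot_circ.
Proof. by elim/quotW=> ?; rewrite -pi_quot_one -pi_quot_circ mulg1. Qed.
Fact quot_mulV : left_inverse quot_one quot_inv quot_circ.
Proof.
by elim/quotW=> ?; rewrite -pi_quot_inv -pi_quot_circ mulVg pi_quot_one.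
Qed.
Fact quot_mulrV : right_inverse quot_one quot_inv quot_circ.
Proof.
by elim/quotW=> ?; rewrite -pi_quot_inv -pi_quot_circ mulgV pi_quot_one.
Qed.

HB.instance Definition _ := isGroup.Build ideal_quot
  quot_circA quot_mul1 quot_mulr1 quot_mulV quot_mulrV.

Fact quot_circDr p q r : quot_circ p (quot_add q r) =
  quot_add (quot_add (quot_circ p q) (quot_opp p)) (quot_circ p r).
Proof.
elim/quotW: p => a; elim/quotW: q => b; elim/quotW: r => c.
have := congr1 \pi_ideal_quot (circDr a b c).
by rewrite !(pi_quot_add, pi_quot_opp, pi_quot_circ).
Qed.
HB.instance Definition _ := isSkewBrace.Build ideal_quot
  quot_addA quot_add0 quot_addN quot_circDr.

End IdealTheory.

(* Main.v *)
From mathcomp Require Import all_boot.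
From mathcomp Require Import boolp classical_sets.
Require Import Defs.

Set Implicit Arguments.
Unset Strict Implicit.
Unset Printing Implicit Defensive.

Local Open Scope classical_set_scope.
Local Open Scope quotient_scope.
Local Open Scope skew_brace_scope.

(** Take [I] to be the intersection of [A2 A] and [A2op A]; both are ideals in
    every skew brace, so [A / I] is weakly trivial.  Expanding
    [(a + b) ∘ (c + d)] with the two distributive laws in either order shows
    that [star a d] and [starop b c] commute, so [A2 A] and [A2op A] centralise
    each other additively and [(I, +)] is abelian. *)

Section AddGenerated.
Variable A : skewBraceType.
Implicit Types (x y z : A) (X H : set A).

Lemma sbaddNK x y : x + (- x + y) = y.
Proof. by rewrite sbaddA sbsubrr sbadd0. Qed.

Lemma add_gen_subgroup X : add_subgroup (add_gen X).
Proof.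
split=> [H [hH _]|x y hx hy H hH|x hx H hH]; first exact: add_subgroup0 hH.
- by apply: (add_subgroupD hH.1); [apply: hx|apply: hy].
- by apply: (add_subgroupN hH.1); apply: hx.
Qed.

Lemma sub_add_gen X : X `<=` add_gen X.
Proof. exact: sub_gen_smallest. Qed.

Lemma add_gen_sub X H : add_subgroup H -> X `<=` H -> add_gen X `<=` H.
Proof. by move=> sH XH; apply: smallest_sub. Qed.

(** Conjugation by [a] is an additive endomorphism, so the preimage of [add_gen X] under it is a
    subgroup; it is enough to test generators. *)
Lemma add_gen_normal X a :
  (forall x, X x -> add_gen X (a + x - a)) ->
  forall x, add_gen X x -> add_gen X (a + x - a).
Proof.
have [g0 gD gN] := add_gen_subgroup X.
move=> nX; apply: (@add_gen_sub _ [set x | add_gen X (a + x - a)]) => //.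
split=> [|x y /= hx hy|x /= hx]; rewrite /=.
- by rewrite sbaddr0 sbsubrr.
- by have := gD _ _ hx hy; rewrite -!sbaddA sbaddK.
- by have := gN _ hx; rewrite !sboppD sboppK -!sbaddA.
Qed.

Lemma add_centraliser_subgroup x : add_subgroup [set y | x + y = y + x].
Proof.
split=> [|y z /= hy hz|y /= hy]; first by rewrite /= sbaddr0 sbadd0.
- by rewrite sbaddA hy -!sbaddA hz.
- by apply: (@sbaddI _ y); rewrite sbaddA -hy -sbaddA sbsubrr sbaddr0 sbaddNK.
Qed.

Lemma add_gen_commute X Y :
  (forall x y, X x -> Y y -> x + y = y + x) ->
  forall x y, add_gen X x -> add_gen Y y -> x + y = y + x.
Proof.
move=> cXY x y hx; apply: (add_gen_sub (add_centraliser_subgroup x)) => {}y Yy /=.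
apply/esym; move: x hx; apply: (add_gen_sub (add_centraliser_subgroup y)).
by move=> x Xx /=; rewrite (cXY x y).
Qed.

End AddGenerated.

Section Ideals.
Variable A : skewBraceType.
Implicit Types (a b c d x y : A) (H : set A).

Lemma circE a b : a ∘ b = a + (- a + a ∘ b).
Proof. by rewrite sbaddNK. Qed.

(** Multiplicative closure comes from [circE]; multiplicative normality is where the condition on
    [star x a] enters. *)
Lemma ideal_of_star H :
  add_subgroup H ->
  (forall a x, H x -> H (a + x - a)) ->
  (forall a x, H x -> H (- a + a ∘ x)) ->
  (forall x a, H x -> H (star x a)) ->
  is_ideal H.
Proof.
move=> sH nH lH starH; have [h0 hD hN] := sH; split=> //.
  split=> [|x y hx hy|x hx]; first by rewrite sb_one.
  - by rewrite circE; apply: hD => //; apply: lH.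
  (* For [a] the inverse of [x], the element [- a + a ∘ x] is just [- a]. *)
  - have := hN _ (lH x^-1%g _ hx).
    by rewrite mulVg sb_one sbaddr0 sboppK.
move=> a x hx.
(* Write [x ∘ a^-1] as [x + star x a^-1 + a^-1]; distributing [a] over the last sum leaves
   [a ∘ a^-1 = 0]. *)
have -> : (a ∘ x ∘ a^-1)%g = a + (- a + a ∘ (x + star x a^-1%g)) - a.
  have -> : (a ∘ x ∘ a^-1)%g = a ∘ (x + star x a^-1%g + a^-1%g).
    by rewrite /star -!sbaddA sbaddN sbaddr0 sbaddNK mulgA.
  by rewrite circDr mulgV sb_one sbaddr0 sbaddNK.
by apply/nH/lH/hD => //; apply: starH.
Qed.

Lemma A2_star a b : A2 A (star a b).
Proof. by apply: sub_add_gen; exists a => //; exists b. Qed.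

Lemma A2op_starop a b : A2op A (starop a b).
Proof. by apply: sub_add_gen; exists a => //; exists b. Qed.

Lemma starDr a b c : star a (b + c) = star a b + (b + star a c - b).
Proof.
by rewrite /star circDr sboppD -!sbaddA sbaddK.
Qed.

Lemma staropDr a b c : starop a (b + c) = - c + starop a b + c + starop a c.
Proof. by rewrite /starop circDr sboppD -!sbaddA sbaddNK. Qed.

(** Solving [starDr] for its last summand writes a conjugate of a generator through two generators,
    and [- a + a ∘ x] equals [star a x + x]. *)
Lemma A2_ideal : is_ideal (A2 A).
Proof.
have [h0 hD hN] := add_gen_subgroup [set star a b | a in [set: A] & b in [set: A]].
apply: ideal_of_star => //; last by move=> *; apply: A2_star.
  move=> b; apply: add_gen_normal => _ [a _] [c _ <-].
  rewrite -(sbaddK (star a b) (_ + _ - _)) -starDr.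
  by apply: hD; [apply: hN|]; apply: A2_star.
move=> a x hx; have := hD _ _ (A2_star a x) hx.
by rewrite /star -!sbaddA sbaddN sbaddr0.
Qed.

Lemma A2op_ideal : is_ideal (A2op A).
Proof.
have [h0 hD hN] := add_gen_subgroup [set starop a b | a in [set: A] & b in [set: A]].
have nH a x : A2op A x -> A2op A (a + x - a).
  move: x; apply: add_gen_normal => _ [b _] [c _ <-].
  have -> : a + starop b c - a = starop b (c - a) - starop b (- a).
    by rewrite staropDr sboppK -[RHS]sbaddA sbsubrr sbaddr0.
  by apply: hD; [|apply: hN]; apply: A2op_starop.
apply: ideal_of_star => // [a x hx|x a hx].
  (* Here [x + starop a x] is [a ∘ x - a], whose conjugate by [- a] is [- a + a ∘ x]. *)
  have := nH (- a) _ (hD _ _ hx (A2op_starop a x)).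
  by rewrite /starop sboppK -!sbaddA sbaddNK sbaddN sbaddr0.
have -> : star x a = - x + (a + starop x a - a) + (a + x - a).
  by rewrite /star /starop -!sbaddA sbaddNK sbaddK sbaddK.
apply: (hD _ _ (hD _ _ (hN _ hx) (nH _ _ _)) (nH _ _ hx)).
exact: A2op_starop.
Qed.

Lemma setI_ideal (H K : set A) : is_ideal H -> is_ideal K -> is_ideal (H `&` K).
Proof.
move=> [[? ? ?] ? [? ? ?] ? ?] [[? ? ?] ? [? ? ?] ? ?].
by split=> [|a x []|||]; [split=> [|x y [? ?] []|x []]| |split=> [|x y [? ?] []|x []]|
  move=> a x []|move=> a x []]; split; auto.
Qed.

Lemma star_starop_commute a b c d : two_sided A ->
  star a d + starop b c = starop b c + star a d.
Proof.
move=> tsA; have := circDr (a + b) c d.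
(* Both expansions begin with [a ∘ c] and end with [b ∘ d]; between them stand [star a d] and
   [starop b c], in opposite orders. *)
rewrite (tsA a b (c + d)) !circDr !tsA !sboppD -!sbaddA => /sbaddI e.
apply: (@sbaddI _ (a ∘ c)); rewrite /star /starop -!sbaddA.
have cancel x y z : x + z = y + z -> x = y.
  by move=> /(congr1 (fun t => t - z)); rewrite -!sbaddA sbsubrr !sbaddr0.
by congr (_ + _); apply: (cancel _ _ (b ∘ d)); rewrite -!sbaddA.
Qed.

Lemma A2_A2op_commute x y : two_sided A -> A2 A x -> A2op A y -> x + y = y + x.
Proof.
move=> tsA; apply: add_gen_commute => _ _ [a _ [d _ <-]] [b _ [c _ <-]].
exact: star_starop_commute.
Qed.

End Ideals.

Lemma two_sided_ideal_sub (A : skewBraceType) (I : ideal A) :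
  two_sided A -> two_sided (ideal_sub I).
Proof. by move=> tsA u v w; apply: val_inj; apply: tsA. Qed.

Section Quotient.
Variables (A : skewBraceType) (I : ideal A).
Local Notation pi := \pi_(ideal_quot I).

(** The projection is additive, so the image of [add_gen X] is a subgroup and only generators need
    lifting. *)
Lemma add_gen_quot (X : set A) (Y : set (ideal_quot I)) :
  Y `<=` pi @` X -> add_gen Y `<=` pi @` add_gen X.
Proof.
have [g0 gD gN] := add_gen_subgroup X.
move=> YX; apply: add_gen_sub => [|y /YX[x Xx <-]]; last first.
  by exists x => //; apply: sub_add_gen.
split=> [|_ _ [x hx <-] [y hy <-]|_ [x hx <-]].
- by exists 0 => //; apply: pi_quot_zero.
- by exists (x + y); [apply: gD|apply: pi_quot_add].
- by exists (- x); [apply: gN|apply: pi_quot_opp].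
Qed.

Lemma A2_quot : A2 (ideal_quot I) `<=` pi @` A2 A.
Proof.
apply: add_gen_quot => _ [p _ [q _ <-]].
elim/quotW: p => a; elim/quotW: q => b.
exists (star a b); first by exists a => //; exists b.
by rewrite /star !(pi_quot_add, pi_quot_opp, pi_quot_circ).
Qed.

Lemma A2op_quot : A2op (ideal_quot I) `<=` pi @` A2op A.
Proof.
apply: add_gen_quot => _ [p _ [q _ <-]].
elim/quotW: p => a; elim/quotW: q => b.
exists (starop a b); first by exists a => //; exists b.
by rewrite /starop !(pi_quot_add, pi_quot_opp, pi_quot_circ).
Qed.

(** A class in both subgroups has representatives [x] in [A2 A] and [y] in [A2op A]. Their
    difference lies in [I], hence in [A2op A], which forces [x] into [A2op A] and so into [I]. *)
Lemma weakly_trivial_quot :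
  ideal_set I = A2 A `&` A2op A -> weakly_trivial (ideal_quot I).
Proof.
move=> defI; apply/seteqP; split=> [z [/A2_quot[x hx <-] /A2op_quot[y hy]]|_ ->].
  move=> /esym/ideal_quotP; rewrite defI => -[/(add_subgroupD (add_gen_subgroup _) hx)].
  rewrite sbaddNK => hy2 hyx.
  rewrite /= -[RHS]/(quot_zero I) -pi_quot_zero.
  apply/ideal_quotP; rewrite sbaddr0; apply: idealN; rewrite defI; split=> //.
  have [_ hD hN] := add_gen_subgroup [set starop a b | a in [set: A] & b in [set: A]].
  have := hN _ (hD _ _ hyx (hN _ hy)).
  by rewrite -sbaddA sbsubrr sbaddr0 sboppK.
by split; apply: add_subgroup0; apply: add_gen_subgroup.
Qed.

End Quotient.

Theorem corollary4p4 (A : skewBraceType) :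
  two_sided A ->
  exists I : ideal A,
    two_sided_brace (ideal_sub I) /\ weakly_trivial (ideal_quot I).
Proof.
move=> tsA; exists (Ideal (setI_ideal (A2_ideal A) (A2op_ideal A))).
split; last exact: weakly_trivial_quot.
split; last exact: two_sided_ideal_sub.
(* View [u] as an element of [A2 A] and [v] as one of [A2op A]. *)
move=> u v; apply: val_inj; apply: A2_A2op_commute => //.
- exact: (ideal_subP u).1.
- exact: (ideal_subP v).2.
Qed.
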